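(* Any randomized protocol that succeeds with probability at least $0.99$ for testing feasibility of distributed linear programs requires $\Omega(s\log L/\log s)$ bits of communication in the coordinator model and $\Omega(s+L)$ bits of communication in the blackboard model. The lower bounds hold even when $d=2$.
   Context: There are $s\ge2$ servers $P_1,\dots,P_s$ and a coordinator. The constraints $Ax\le b$ of a linear program in $d$ variables, with coefficients of bit complexity $L$, are partitioned row-wise among the servers. Feasibility testing: the coordinator must report whether $Ax\le b$ is feasible. Coordinator model: servers communicate only with the coordinator through private channels; blackboard model: all messages are broadcast on a shared blackboard whose contents determine who speaks next. Communication complexity is the total number of bits sent. *)

(* Defs.v *)
From HB Require Import structures.
From mathcomp Require Import all_boot all_order all_algebra.
From mathcomp Require Import all_classical all_reals all_analysis.

Set Implicit Arguments.
Unset Strict Implicit.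
Unset Printing Implicit Defensive.

Import Order.TTheory GRing.Theory Num.Theory.
Local Open Scope classical_set_scope.
Local Open Scope ring_scope.

(* Coefficients are integers with L-bit magnitude (plus a sign). *)
Definition bit_complexity (L n d : nat) (A : 'M[int]_(n, d)) (b : 'cV[int]_n) :=
  (forall i j, `|A i j| < 2 ^+ L) /\ (forall i, `|b i 0| < 2 ^+ L).

Definition lp_feasible (R : realType) (n d : nat)
    (A : 'M[int]_(n, d)) (b : 'cV[int]_n) : Prop :=
  exists x : 'cV[R]_d,
    forall i, (map_mx intr A *m x) i 0 <= (b i 0)%:~R.

Definition constraint (d : nat) : Type := ('rV[int]_d * int)%type.

(* [owner k] is the server holding row [k]; a server sees only its own rows. *)
Definition server_rows (s n d : nat) (A : 'M[int]_(n, d)) (b : 'cV[int]_n)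
    (owner : 'I_n -> 'I_s) (i : 'I_s) : seq (constraint d) :=
  [seq (row k A, b k 0) | k <- enum 'I_n & owner k == i].

(* Deterministic blackboard protocols, bit by bit. A position in the tree is
   the content of the blackboard; it fixes the next speaker, and a server's bit
   depends on that content and on the server's own input. The coordinator has
   no input, so its bit is a function of the content alone. *)
Inductive bb_protocol (s : nat) (X : Type) : Type :=
| BBReport of bool
| BBCoordinator of bool & bb_protocol s X
| BBServer of 'I_s & (X -> bool) & (bool -> bb_protocol s X).

Fixpoint bb_output (s : nat) (X : Type) (p : bb_protocol s X)
    (x : 'I_s -> X) : bool :=
  match p with
  | BBReport o => o
  | BBCoordinator _ q => bb_output q x
  | BBServer i f q => bb_output (q (f (x i))) x
  end.

Fixpoint bb_bits (s : nat) (X : Type) (p : bb_protocol s X)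
    (x : 'I_s -> X) : nat :=
  match p with
  | BBReport _ => 0%N
  | BBCoordinator _ q => (bb_bits q x).+1
  | BBServer i f q => (bb_bits (q (f (x i))) x).+1
  end.

(* The coordinator's side of a deterministic coordinator-model protocol. A
   position in the tree is everything the coordinator has seen so far: there it
   reports, or sends one bit to a server, or receives one bit from a server. *)
Inductive coordinator (s : nat) : Type :=
| CReport of bool
| CSend of 'I_s & bool & coordinator s
| CReceive of 'I_s & (bool -> coordinator s).

(* The bits exchanged on one private channel, in order: [inl] for those sent by
   the coordinator, [inr] for those sent by the server. *)
Definition channel : Type := seq (bool + bool)%type.

(* The bit sent by server [i] depends only on its own input and on the content
   of its own channel. *)
Record coord_protocol (s : nat) (X : Type) : Type := CoordProtocol {
  coord_side : coordinator s;
  server_side : 'I_s -> X -> channel -> bool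
}.

Definition append_channel (s : nat) (h : 'I_s -> channel) (i : 'I_s)
    (m : bool + bool) : 'I_s -> channel :=
  fun j => if j == i then rcons (h j) m else h j.

(* Output and number of bits exchanged, starting from channel contents [h]. *)
Fixpoint coord_run (s : nat) (c : coordinator s)
    (f : 'I_s -> channel -> bool) (h : 'I_s -> channel) : bool * nat :=
  match c with
  | CReport o => (o, 0%N)
  | CSend i m c' =>
      let r := coord_run c' f (append_channel h i (inl m)) in (r.1, r.2.+1)
  | CReceive i k =>
      let m := f i (h i) in
      let r := coord_run (k m) f (append_channel h i (inr m)) in (r.1, r.2.+1)
  end.

Definition coord_exec (s : nat) (X : Type) (p : coord_protocol s X)
    (x : 'I_s -> X) : bool * nat :=
  coord_run (coord_side p) (fun i => server_side p i (x i)) (fun=> [::]).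

Definition coord_output (s : nat) (X : Type) (p : coord_protocol s X)
    (x : 'I_s -> X) : bool := (coord_exec p x).1.

Definition coord_bits (s : nat) (X : Type) (p : coord_protocol s X)
    (x : 'I_s -> X) : nat := (coord_exec p x).2.

(* A randomized protocol is a deterministic protocol drawn at random, i.e. a
   family indexed by a probability space; private coins are the special case of
   a product space in which each party reads only its own coordinate. Below,
   [out r x] and [bits r x] are the output and the number of bits sent on the
   server inputs [x] with coins [r]. *)
Definition tests_feasibility (R : realType) (dsp : measure_display)
    (T : measurableType dsp) (P : probability T R) (s d L : nat)
    (out : T -> ('I_s -> seq (constraint d)) -> bool) : Prop :=
  forall (n : nat) (A : 'M[int]_(n, d)) (b : 'cV[int]_n) (owner : 'I_n -> 'I_s),
    bit_complexity L A b ->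
    let success :=
      [set r | out r (server_rows A b owner) = `[< lp_feasible R A b >]] in
    measurable success /\ ((99 / 100)%:E <= P success)%E.

Definition sends_at_most (T : Type) (s d L : nat)
    (bits : T -> ('I_s -> seq (constraint d)) -> nat) (C : nat) : Prop :=
  forall (n : nat) (A : 'M[int]_(n, d)) (b : 'cV[int]_n) (owner : 'I_n -> 'I_s),
    bit_complexity L A b ->
    forall r : T, (bits r (server_rows A b owner) <= C)%N.

(* Main.v *)
(** Both bounds follow from the single bound [C >= (s + L) / 10] for blackboard
    protocols: a blackboard simulates private channels at no cost, and
    [s log L / log s = O(s + L)] (compare [L] with [s ^ 2]).

    For [C = Omega(s)], one server asks for [x >= 1] and at most one of the
    others for [x <= 0]. On the feasible input at most [C] servers speak, and a
    silent server can make the instance infeasible without being noticed.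

    For [C = Omega(L)], the indexing problem of a string [z] of length [4 ^ m],
    [m = L / 4], is encoded with tangents to a parabola. With [t] and [z]
    uniform, a protocol with [C] bits splits the inputs into [2 ^ C] rectangles,
    on each of which [(-1) ^ (z t)] has correlation at most [2 ^ -m]. *)

Require Import Defs.
From HB Require Import structures.
From mathcomp Require Import all_boot all_order all_algebra.
From mathcomp Require Import all_classical all_reals all_analysis.
From mathcomp Require Import measurable_realfun zify lra.

Set Implicit Arguments.
Unset Strict Implicit.
Unset Printing Implicit Defensive.

Import Order.TTheory GRing.Theory Num.Theory.
Local Open Scope ring_scope.

(** * Private channels simulated on a blackboard *)

(** The channel contents [h] are fixed by the position in the tree, so server [i] can recover [h i]
    from the blackboard and no extra bit is sent. *)
Fixpoint bb_of_coord (s : nat) (X : Type) (g : 'I_s -> X -> channel -> bool)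
    (c : coordinator s) (h : 'I_s -> channel) : bb_protocol s X :=
  match c with
  | CReport o => BBReport s X o
  | CSend i m c' =>
      BBCoordinator m (bb_of_coord g c' (append_channel h i (inl m)))
  | CReceive i k => BBServer i (fun y => g i y (h i))
      (fun m => bb_of_coord g (k m) (append_channel h i (inr m)))
  end.

Lemma bb_of_coordE s X (g : 'I_s -> X -> channel -> bool) c h x :
  (bb_output (bb_of_coord g c h) x, bb_bits (bb_of_coord g c h) x) =
  coord_run c (fun i => g i (x i)) h.
Proof.
elim: c h => [b0|i m c IH|i k IH] h //=.
  by rewrite -(IH (append_channel h i (inl m))).
by rewrite -(IH (g i (x i) (h i)) (append_channel h i (inr (g i (x i) (h i))))).
Qed.

(** * Sensitivity of the output to a single server *)

(** A server silent on [x] cannot alter the run by changing its own input. So every counted [j]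
    speaks on [x], and there are at most as many speakers as bits. *)
Lemma card_output_change s X (p : bb_protocol s X) (x : 'I_s -> X)
    (y : 'I_s -> 'I_s -> X) :
  (forall j i, i != j -> y j i = x i) ->
  (#|[set j | bb_output p (y j) != bb_output p x]| <= bb_bits p x)%N.
Proof.
move=> yx; elim: p => [b0|b p IH|i f q IH] /=.
- by rewrite leqn0 cards_eq0; apply/eqP/setP => j; rewrite !inE eqxx.
- exact: leqW.
(* Changing the input of any [j] other than [i] keeps this bit, so only [i] can leave the subtree
   followed by [x]. *)
- apply: (@leq_trans #|i |: [set j | bb_output (q (f (x i))) (y j) !=
                                     bb_output (q (f (x i))) x]|).
    apply/subset_leq_card/fintype.subsetP => j; rewrite !inE.
    have [->//|ji] := eqVneq j i.
    by rewrite (yx j i) // eq_sym.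
  rewrite cardsU1; apply: (@leq_trans (1 + #|[set j |
     bb_output (q (f (x i))) (y j) != bb_output (q (f (x i))) x]|)).
    by rewrite leq_add2r; case: (_ \notin _).
  by rewrite add1n ltnS; exact: IH.
Qed.

(** * Discrepancy bound for protocols *)

Section Discrepancy.
Variables (R : realDomainType) (I J : finType) (sg : I -> J -> R) (D : R).
Hypothesis discD : forall (A : pred I) (B : pred J),
  `|\sum_(t | A t) \sum_(z | B z) sg t z| <= D.
Variables (s : nat) (X : Type) (x : I -> J -> 'I_s -> X).
Hypothesis x_split : forall i,
  (exists g : I -> X, forall t z, x t z i = g t) \/
  (exists g : J -> X, forall t z, x t z i = g z).

(** Each server sees only [t] or only [z], so its bit cuts the rectangle [A] by [B] along one side;
    the leaves are rectangles on which the output is constant. *)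
Lemma bb_discrepancy (p : bb_protocol s X) C (A : pred I) (B : pred J) :
  (forall t z, A t -> B z -> (bb_bits p (x t z) <= C)%N) ->
  `|\sum_(t | A t) \sum_(z | B z) sg t z * (-1) ^+ bb_output p (x t z)|
    <= 2 ^+ C * D.
Proof.
have D0 : 0 <= D by apply: le_trans (discD pred0 pred0).
have D2 k : 0 <= 2 ^+ k * D by rewrite mulr_ge0// exprn_ge0.
elim: p C A B => [b0|b p IH|i f q IH] C A B /= bitsC.
  under eq_bigr do rewrite -mulr_suml.
  rewrite -mulr_suml normrM normrX normrN1 expr1n mulr1.
  by apply: (le_trans (discD A B)); rewrite ler_peMl// exprn_ege1// ler1n.
(* An empty rectangle contributes 0; at a point of a nonempty one a bit is sent, so [C] is a
   successor. *)
all: have [[t tA]|A0] := pselect (exists t, A t);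
  last by rewrite big1 ?normr0// => t tA; case: A0; exists t.
all: have [[z zB]|B0] := pselect (exists z, B z); last first;
  try by rewrite big1 ?normr0// => t' _; rewrite big1// => z zB;
         case: B0; exists z.
all: case: C bitsC => [|C] bitsC; first by have := bitsC t z tA zB.
  apply: (@le_trans _ _ (2 ^+ C * D)).
    by apply: IH => t' z' /bitsC /[apply].
  by rewrite ler_wpM2r// ler_eXn2l// ?ltr1n// leqnSn.
(* One copy of [2 ^+ C * D] for each half of the rectangle. *)
rewrite exprS -mulrA mulr_natl mulr2n.
have [[g xg]|[g xg]] := x_split i.
- rewrite (bigID (fun t => f (g t))) /=.
  apply: (le_trans (ler_normD _ _)); apply: lerD.
  + under eq_bigr => t' /andP[_ ft'] do under eq_bigr do rewrite xg ft'.
    apply: (IH true C [pred t | A t && f (g t)] B) => t' z' /andP[t'A ft'] z'B.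
    by have := bitsC t' z' t'A z'B; rewrite xg ft'.
  + under eq_bigr => t' /andP[_ /negbTE ft'] do under eq_bigr do rewrite xg ft'.
    apply: (IH false C [pred t | A t && ~~ f (g t)] B) => t' z' /andP[t'A].
    by move=> /negbTE ft' z'B; have := bitsC t' z' t'A z'B; rewrite xg ft'.
- under eq_bigr do rewrite (bigID (fun z => f (g z))) /=.
  rewrite big_split /=.
  apply: (le_trans (ler_normD _ _)); apply: lerD.
  + under eq_bigr do under eq_bigr => z' /andP[_ fz'] do rewrite xg fz'.
    apply: (IH true C A [pred z | B z && f (g z)]) => t' z' t'A /andP[z'B fz'].
    by have := bitsC t' z' t'A z'B; rewrite xg fz'.
  + under eq_bigr do under eq_bigr => z' /andP[_ /negbTE fz'] do rewrite xg fz'.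
    apply: (IH false C A [pred z | B z && ~~ f (g z)]) => t' z' t'A /andP[z'B].
    by move=> /negbTE fz'; have := bitsC t' z' t'A z'B; rewrite xg fz'.
Qed.
End Discrepancy.

(** * Discrepancy of the indexing problem *)

Section IndexDiscrepancy.
Variable (R : realFieldType).

(** Off the diagonal, flipping [z] at [t] is an involution that negates every term. *)
Lemma sum_signs_orthogonal (N : nat) (t t' : 'I_N) :
  \sum_(z : {ffun 'I_N -> bool}) (-1) ^+ z t * (-1) ^+ z t' =
  (2 ^ N)%:R *+ (t == t') :> R.
Proof.
have [<-|tt'] := eqVneq t t'.
  under eq_bigr do rewrite -expr2 sqrr_sign.
  by rewrite sumr_const card_ffun card_bool card_ord mulr1n.
pose flip (z : {ffun 'I_N -> bool}) := [ffun u => z u (+) (u == t)].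
have flipK : involutive flip.
  by move=> z; apply/ffunP => u; rewrite !ffunE -addbA addbb addbF.
set S := \sum_z _; rewrite mulr0n.
suff : S = - S by move=> h; lra.
rewrite {1}/S (reindex_inj (inv_inj flipK)) /= -sumrN.
apply: eq_bigr => z _; rewrite !ffunE eqxx eq_sym (negbTE tt') addbF addbT.
by rewrite signrN mulNr.
Qed.

(* [2 c |v| <= v^2 + c^2] with [c = 2 ^ m] replaces Cauchy-Schwarz. *)
Lemma index_discrepancy (m : nat) (A : pred 'I_(4 ^ m))
    (B : pred {ffun 'I_(4 ^ m) -> bool}) :
  `|\sum_(t | A t) \sum_(z | B z) (-1) ^+ z t| <= 2 ^+ m * 2 ^+ (4 ^ m) :> R.
Proof.
set N := (4 ^ m)%N in A B *.
have Nc : N%:R = (2 ^+ m) ^+ 2 :> R.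
  by rewrite /N -exprM mulnC exprM -natrX natrX.
set c : R := 2 ^+ m in Nc *.
have c0 : 0 < c by rewrite exprn_gt0.
pose v z : R := \sum_(t | A t) (-1) ^+ (z : {ffun 'I_N -> bool}) t.
rewrite exchange_big /=.
rewrite -(@ler_pM2l _ (2 * c)) ?mulr_gt0//.
apply: (@le_trans _ _ (\sum_(z | B z) (v z ^+ 2 + c ^+ 2))).
  apply: (@le_trans _ _ (2 * c * \sum_(z | B z) `|v z|)).
    by rewrite ler_pM2l ?mulr_gt0// ler_norm_sum.
  rewrite mulr_sumr; apply: ler_sum => z _.
  by have := sqr_ge0 (`|v z| - c); rewrite -(real_normK (num_real (v z))); lra.
(* Enlarging [B] to all strings makes orthogonality of the signs applicable to the second moment. *)
apply: (@le_trans _ _ (\sum_z (v z ^+ 2 + c ^+ 2))).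
  rewrite [leRHS](bigID B)/= lerDl sumr_ge0// => z _.
  by rewrite addr_ge0// sqr_ge0.
rewrite big_split /= sumr_const card_ffun card_bool card_ord.
have -> : \sum_z v z ^+ 2 = (2 ^ N)%:R *+ #|A|.
  rewrite /v; under eq_bigr do rewrite expr2 big_distrlr /=.
  rewrite exchange_big /= -sumr_const; apply: eq_bigr => t tA.
  rewrite exchange_big /=.
  under eq_bigr do rewrite sum_signs_orthogonal.
  rewrite (bigD1 t)//= eqxx mulr1n big1 ?addr0// => t' /andP[_].
  by rewrite eq_sym => /negbTE ->; rewrite mulr0n.
rewrite -[c ^+ 2 *+ _]mulr_natr -[_ *+ #|A|]mulr_natr.
(* Both summands are then at most [c ^+ 2 * 2 ^+ N], in total [2 * c] times the claimed bound. *)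
have AN : #|A|%:R <= c ^+ 2 :> R.
  by rewrite -Nc ler_nat (leq_trans (max_card _))// card_ord.
rewrite natrX; set W : R := 2 ^+ N.
have W0 : 0 < W by rewrite exprn_gt0.
nra.
Qed.
End IndexDiscrepancy.

(** * Averaging over the coins *)

(** The easy direction of Yao's principle: the expected number of [j] with [S j] is at least
    [a * #|J|] and at most its pointwise bound [W]. *)
Lemma mul_card_le_of_prob (R : realType) (dsp : measure_display)
    (T : measurableType dsp) (P : probability T R) (J : finType)
    (S : J -> set T) (a W : R) :
  (forall j, measurable (S j) /\ (a%:E <= P (S j))%E) ->
  (forall r, #|[pred j | `[< S j r >]]|%:R <= W) ->
  a * #|J|%:R <= W.
Proof.
move=> PS SW.
have T0 : (@setT T !=set0)%classic.
  apply/set0P/eqP => T0; have := @probability_setT _ _ _ P.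
  by rewrite T0 measure0 => /eqP; rewrite eqe eq_sym oner_eq0.
have W0 : 0 <= W by have [r _] := T0; apply: le_trans (SW r).
rewrite -lee_fin.
apply: (@le_trans _ _ (\sum_(j : J) P (S j))%E).
  rewrite mulr_natr -sumr_const -sumEFin.
  by apply: lee_sum => j _; case: (PS j).
under eq_bigr do rewrite -[S _]setIT -(integral_indic P measurableT (PS _).1).
have mS j : measurable_fun setT (\1_(S j) : T -> R).
  by apply: measurable_indic; exact: (PS j).1.
rewrite -ge0_integral_sum//=; last by move=> j; exact/measurable_EFinP.
apply: (@le_trans _ _ (\int[P]_(r in setT) (cst W%:E) r)%E).
  apply: ge0_le_integral => //.
  - by move=> r _; apply: sume_ge0 => j _; rewrite lee_fin.
  - by apply: emeasurable_sum => j; exact/measurable_EFinP.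
  - move=> r _; rewrite sumEFin lee_fin; apply: le_trans (SW r).
    rewrite -sum1_card natr_sum [leRHS]big_mkcond /=.
    apply: ler_sum => j _; rewrite indicE inE /=.
    by case: asboolP => Sr; [rewrite mem_set|rewrite memNset].
rewrite integral_cst//.
by rewrite -[leRHS]mule1; have <- := @probability_setT _ _ _ P.
Qed.

(** * Linear programs in two effective variables *)

(** Zero columns after the first two carry planar instances to every dimension [d >= 2]. *)
Definition planar_mx (n d : nat) (p q : 'I_n -> int) : 'M[int]_(n, d) :=
  \matrix_(i, j) (if j == 0 :> nat then p i else
                  if j == 1 :> nat then q i else 0).

Lemma planar_feasible (R : realType) (n d : nat) (p q : 'I_n -> int)
    (b : 'cV[int]_n) :
  lp_feasible R (planar_mx d.+2 p q) b <->
  exists x y : R, forall i, (p i)%:~R * x + (q i)%:~R * y <= (b i 0)%:~R.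
Proof.
have lhs (x : 'cV[R]_d.+2) i : (map_mx intr (planar_mx d.+2 p q) *m x) i 0 =
    (p i)%:~R * x ord0 0 + (q i)%:~R * x (lift ord0 ord0) 0.
  rewrite mxE !big_ord_recl big1 ?addr0; first by rewrite !mxE.
  by move=> j _; rewrite !mxE /= mul0r.
split=> [[x xb]|[x [y xyb]]].
  by exists (x ord0 0), (x (lift ord0 ord0) 0) => i; rewrite -lhs.
exists (\col_j (if j == 0 :> nat then x else y)) => i.
by rewrite lhs !mxE /=.
Qed.

Lemma planar_bit_complexity (L n d : nat) (p q : 'I_n -> int) (b : 'cV[int]_n) :
  (forall i, `|p i| < 2 ^+ L) -> (forall i, `|q i| < 2 ^+ L) ->
  (forall i, `|b i 0| < 2 ^+ L) -> bit_complexity L (planar_mx d p q) b.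
Proof.
move=> pL qL bL; split=> // i j; rewrite mxE; case: ifP => // _.
by case: ifP => // _; rewrite normr0 exprn_gt0.
Qed.

Lemma eq_server_rows (s n d : nat) (owner : 'I_n -> 'I_s) (i : 'I_s)
    (A A' : 'M[int]_(n, d)) (b b' : 'cV[int]_n) :
  (forall k, owner k = i -> row k A = row k A' /\ b k 0 = b' k 0) ->
  server_rows A b owner i = server_rows A' b' owner i.
Proof.
move=> AA'; apply/eq_in_map => k; rewrite mem_filter => /andP[/eqP /AA'].
by case=> -> ->.
Qed.

Lemma eq_planar_row (n d : nat) (p q p' q' : 'I_n -> int) k :
  p k = p' k -> q k = q' k ->
  row k (planar_mx d p q) = row k (planar_mx d p' q').
Proof. by move=> pp' qq'; apply/rowP => j; rewrite !mxE pp' qq'. Qed.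

(** * Lower bound linear in the number of servers *)

(* Server [0] asks for [x >= 1]; server [j], if [j != 0], asks for [x <= 0];
   the other rows are trivial. *)
Definition or_mx (s d : nat) (j : 'I_s.+1) : 'M[int]_(s.+1, d) :=
  planar_mx d (fun k => if k == ord0 then -1 else if k == j then 1 else 0)
    (fun=> 0).

Definition or_cV (s : nat) : 'cV[int]_s.+1 :=
  \col_k (if k == ord0 then -1 else 0).

Lemma or_feasible (R : realType) (s d : nat) (j : 'I_s.+1) :
  lp_feasible R (or_mx d.+2 j) (or_cV s) <-> j = ord0.
Proof.
rewrite planar_feasible; split=> [[x [y xy]]|->].
  apply/eqP; apply: contraT => j0; have := xy ord0; have := xy j.
  by rewrite !mxE eqxx (negbTE j0) eqxx /=; lra.
by exists 1, 0 => k; rewrite !mxE; case: (k == ord0) => /=; lra.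
Qed.

Lemma or_bit_complexity (L s d : nat) (j : 'I_s.+1) : (1 <= L)%N ->
  bit_complexity L (or_mx d j) (or_cV s).
Proof.
move=> L1; have L2 : 1 < 2 ^+ L :> int by rewrite exprn_egt1// -lt0n.
apply: planar_bit_complexity => k; rewrite ?mxE; do 2?case: ifP => _;
  rewrite ?normrN1 ?normr1 ?normr0//; exact: lt_trans L2.
Qed.

Lemma bb_servers_lower_bound (R : realType) (s d L : nat)
    (dsp : measure_display) (T : measurableType dsp) (P : probability T R)
    (prot : T -> bb_protocol s.+1 (seq (constraint d.+2))) (C : nat) :
  (1 <= L)%N ->
  tests_feasibility P L (fun r => bb_output (prot r)) ->
  sends_at_most L (fun r => bb_bits (prot r)) C ->
  98 / 100 * s%:R <= C%:R :> R.
Proof.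
move=> L1 test send.
pose x j := server_rows (or_mx d.+2 j) (or_cV s) id.
(* The Boolean gives the feasible instance half of the weight; the other half is uniform over the
   [s] infeasible ones. *)
pose J : finType := ('I_s * bool)%type.
pose idx (e : J) := if e.2 then lift ord0 e.1 else ord0 : 'I_s.+1.
pose S (e : J) := [set r | bb_output (prot r) (x (idx e)) =
  `[< lp_feasible R (or_mx d.+2 (idx e)) (or_cV s) >]]%classic.
have SE e r : S e r <-> bb_output (prot r) (x (idx e)) = ~~ e.2.
  rewrite /S /= (_ : `[< _ >] = ~~ e.2)//; apply/asboolP/idP.
    by rewrite or_feasible /idx; case: e.2.
  by rewrite or_feasible /idx; case: e.2.
suff : 99 / 100 * #|J|%:R <= (s + C)%:R :> R.
  by rewrite card_prod card_ord card_bool natrM natrD; lra.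
apply: (@mul_card_le_of_prob _ _ _ P _ S).
  by move=> e; apply: test; exact: or_bit_complexity.
move=> r; rewrite ler_nat.
have xE j i : i != j -> x j i = x ord0 i.
  move=> ij; apply: eq_server_rows => k kE; split=> //.
  by apply: eq_planar_row => //; rewrite kE (negbTE ij); case: ifP.
have chg := card_output_change (prot r) xE.
have {chg} chgC := leq_trans chg
  (send _ _ _ _ (or_bit_complexity d.+2 ord0 L1) r).
set Q := [set j | _] in chgC.
pose Q' := [set i : 'I_s | lift ord0 i \in Q]%SET.
have Q'C : (#|Q'| <= C)%N.
  apply: leq_trans chgC; rewrite -(card_imset _ (@lift_inj _ ord0)).
  apply/subset_leq_card/fintype.subsetP => _ /imsetP[i iQ ->].
  by move: iQ; rewrite inE.
rewrite -sum1_card big_mkcond /=.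
rewrite (eq_bigr (fun e : J =>
  (bb_output (prot r) (x (idx e)) == ~~ e.2) : nat)); last first.
  move=> e _; rewrite inE; case: asboolP => [/SE ->|/SE/eqP/negbTE ->//].
  by rewrite eqxx.
rewrite -(pair_bigA _ (fun i b =>
  (bb_output (prot r) (x (idx (i, b))) == ~~ b) : nat)) /=.
(* For each [i], both answers can be right only if the output changes with server [i + 1]; otherwise
   at most one is. *)
apply: (@leq_trans (\sum_(i < s) (1 + (i \in Q')))).
  apply: leq_sum => i _; rewrite big_bool /idx /= !inE.
  by case: bb_output; case: bb_output.
rewrite big_split /= sum1_card card_ord leq_add2l; apply: leq_trans Q'C.
rewrite -sum1_card [leqRHS]big_mkcond /=.
by apply: leq_sum => i _; case: ifP.
Qed.

(** * Lower bound linear in the bit complexity *)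

(* Server [0] asks for [y <= 2 t x - t^2], a tangent to the parabola
   [y = x^2]; server [1] asks for [y >= 2 u x - u^2 + (1 - z u)] for all [u].
   These are compatible at [(t, t^2)] when [z t], and contradict each other for
   [u = t] otherwise. *)
Definition index_mx (N d : nat) (t : 'I_N) : 'M[int]_(N.+1, d) :=
  planar_mx d
    (fun k => if unlift ord0 k is Some u then 2 * (u : nat)%:Z
              else - (2 * (t : nat)%:Z))
    (fun k => if unlift ord0 k is Some _ then -1 else 1).

Definition index_cV (N : nat) (t : 'I_N) (z : {ffun 'I_N -> bool}) :
    'cV[int]_N.+1 :=
  \col_k (if unlift ord0 k is Some u then (u : nat)%:Z ^+ 2 - (~~ z u : nat)%:Z
          else - (t : nat)%:Z ^+ 2).

Definition index_owner (s N : nat) (k : 'I_N.+1) : 'I_s.+2 :=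
  if unlift ord0 k is Some _ then lift ord0 ord0 else ord0.

Lemma index_feasible (R : realType) (N d : nat) (t : 'I_N)
    (z : {ffun 'I_N -> bool}) :
  lp_feasible R (index_mx d.+2 t) (index_cV t z) <-> z t.
Proof.
rewrite planar_feasible; split=> [[x [y xy]]|zt].
  apply: contraT => /negPf zt; have := xy ord0; have := xy (lift ord0 t).
  rewrite !mxE liftK unlift_none zt /=.
  rewrite !(rmorphB, rmorphN, rmorphM, rmorphXn) /= -?pmulrn; lra.
exists t%:R, (t%:R ^+ 2) => k; rewrite mxE; case: unliftP => [u _|_].
  rewrite !(rmorphB, rmorphN, rmorphM, rmorphXn) /= -?pmulrn.
  case: (boolP (z u)) => zu /=.
    by have := sqr_ge0 (t%:R - u%:R : R); lra.
  (* Row [u] reduces to [(t - u)^2 >= 1], true of distinct integers; [z] differs at [t] and [u]. *)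
  have tu : (t : nat) != u by apply: contraNneq zu => /val_inj <-.
  suff : 1 <= (t%:R - u%:R) ^+ 2 :> R by lra.
  have [tu'|ut'] := ltnP t u.
    suff : (t.+1)%:R <= u%:R :> R by rewrite -natr1; nra.
    by rewrite ler_nat.
  suff : (u.+1)%:R <= t%:R :> R by rewrite -natr1; nra.
  by rewrite ler_nat ltn_neqAle eq_sym tu.
rewrite !(rmorphB, rmorphN, rmorphM, rmorphXn) /= -?pmulrn; lra.
Qed.

(** The squares on the right-hand side stay below [(4 ^ m) ^ 2 = 2 ^ (4 * m)], whence the condition
    on [m]. *)
Lemma index_bit_complexity (L m d : nat) (t : 'I_(4 ^ m))
    (z : {ffun 'I_(4 ^ m) -> bool}) : (1 <= L)%N -> (4 * m <= L)%N ->
  bit_complexity L (index_mx d t) (index_cV t z).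
Proof.
move=> L1 mL; have L2 : 1 < 2 ^+ L :> int by rewrite exprn_egt1// -lt0n.
have sqN : ((4 ^ m) ^ 2 <= 2 ^ L)%N.
  by rewrite -[4%N]/(2 ^ 2)%N -!expnM leq_exp2l//; lia.
have sqL (u : 'I_(4 ^ m)) : (u : nat)%:Z ^+ 2 < 2 ^+ L.
  by rewrite -!natrX !natz ltz_nat (leq_trans _ sqN)// ltn_sqr.
have dbL (u : 'I_(4 ^ m)) : 2 * (u : nat)%:Z < 2 ^+ L.
  (* The comparison [2 * u <= u ^ 2] fails at [u = 1], so small [u] are treated apart. *)
  have [u1|] := leqP u 1; last first.
    by move=> u2; apply: le_lt_trans (sqL u); rewrite expr2; nia.
  have [m0|m0] := posnP m.
    by have := ltn_ord u; rewrite {2}m0 expn0 ltnS leqn0 => /eqP ->; lia.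
  apply: (@lt_le_trans _ _ (2 ^+ 2)); first by lia.
  by rewrite ler_eXn2l//; lia.
apply: planar_bit_complexity => k; rewrite ?mxE; case: unliftP => [u _|_];
  rewrite ?normrN ?normrX ?normr1//.
- by rewrite normrM !ger0_norm.
- by rewrite normrM !ger0_norm.
- have := sqL u; have := sqr_ge0 (u : nat)%:Z; case: (z u) => /=; lia.
- by rewrite ger0_norm.
Qed.

Lemma bb_bits_lower_bound (R : realType) (s d L m : nat)
    (dsp : measure_display) (T : measurableType dsp) (P : probability T R)
    (prot : T -> bb_protocol s.+2 (seq (constraint d.+2))) (C : nat) :
  (1 <= L)%N -> (4 * m <= L)%N ->
  tests_feasibility P L (fun r => bb_output (prot r)) ->
  sends_at_most L (fun r => bb_bits (prot r)) C ->
  (m <= C)%N.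
Proof.
move=> L1 mL test send.
pose N := (4 ^ m)%N.
pose x (t : 'I_N) z :=
  server_rows (index_mx d.+2 t) (index_cV t z) (@index_owner s N).
pose J : finType := ('I_N * {ffun 'I_N -> bool})%type.
pose S (e : J) := [set r | bb_output (prot r) (x e.1 e.2) =
  `[< lp_feasible R (index_mx d.+2 e.1) (index_cV e.1 e.2) >]]%classic.
have SE e r : S e r <-> bb_output (prot r) (x e.1 e.2) = e.2 e.1.
  by rewrite /S /= (_ : `[< _ >] = e.2 e.1)//; apply/asboolP/idP;
    rewrite index_feasible.
(* Right plus wrong answers make [N * 2 ^ N], and right minus wrong is bounded by the discrepancy;
   [W] is half the sum. *)
pose W : R := (N%:R * 2 ^+ N + 2 ^+ C * (2 ^+ m * 2 ^+ N)) / 2.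
have : 99 / 100 * #|J|%:R <= W.
  apply: (@mul_card_le_of_prob _ _ _ P _ S).
    by move=> e; apply: test; exact: index_bit_complexity.
  move=> r.
  have xS i : (exists g, forall t z, x t z i = g t) \/
              (exists g, forall t z, x t z i = g z).
    (* Server 0 depends on [t] alone and every other server on [z] alone, so any fixed value serves
       for the other argument. *)
    have [->|i0] := eqVneq i ord0; [left|right].
      exists (fun t => x t [ffun=> true] ord0) => t z.
      apply: eq_server_rows => k kE; split=> //; rewrite !mxE.
      by move: kE; rewrite /index_owner; case: unliftP.
    have N0 : (0 < N)%N by rewrite expn_gt0.
    exists (fun z => x (Ordinal N0) z i) => t z.
    apply: eq_server_rows => k kE.
    move: i0; rewrite -kE /index_owner !mxE => ko.
    by split; [apply: eq_planar_row|]; move: ko; case: unliftP.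
  have := @bb_discrepancy R _ _
    (fun (t : 'I_N) (z : {ffun 'I_N -> bool}) => (-1) ^+ z t)
    _ (@index_discrepancy R m) _ _ x xS (prot r) C predT predT.
  move=> /(_ (fun t z _ _ =>
    send _ _ _ _ (index_bit_complexity d.+2 t z L1 mL) r)).
  move=> /(le_trans (ler_norm _)).
  rewrite pair_big /= => disc.
  (* The product of signs is 1 on a right answer and -1 on a wrong one. *)
  have sgE (e : J) : (-1) ^+ e.2 e.1 * (-1) ^+ bb_output (prot r) (x e.1 e.2) =
      2 * (`[< S e r >] : nat)%:R - 1 :> R.
    case: asboolP => [/SE ->|/SE]; first
      by rewrite -expr2 sqrr_sign /= mulr1; lra.
    by case: (e.2 e.1); case: (bb_output _ _) => //= _;
      rewrite ?expr0 ?expr1 ?mulr0n; lra.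
  move: disc; under eq_bigr do rewrite sgE.
  rewrite sumrB -mulr_sumr -natr_sum sumr_const card_prod card_ord card_ffun.
  rewrite card_bool card_ord.
  rewrite (_ : (\sum_e _)%N = #|[pred j | `[< S j r >]]|); last first.
    rewrite -sum1_card [RHS]big_mkcond /=; apply: eq_bigr => e _.
    by rewrite inE; case: `[< _ >].
  by rewrite natrM natrX /W; lra.
rewrite card_prod card_ffun card_bool !card_ord natrM natrX /W.
have -> : N%:R = 2 ^+ m * 2 ^+ m :> R.
  by rewrite /N natrX -exprMn; congr (_ ^+ _); lra.
have m0 : 0 < 2 ^+ m :> R by rewrite exprn_gt0.
have W0 : 0 < 2 ^+ N :> R by rewrite exprn_gt0.
move: W0 m0; rewrite leqNgt; set a := 2 ^+ N; set b := 2 ^+ m => a0 b0 h.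
apply/negP => Cm.
(* If [C < m], this contradicts [98 / 100 * b <= 2 ^+ C], which is [h] divided by [b * a]. *)
have : 2 * 2 ^+ C <= b by rewrite -exprS /b ler_eXn2l// ltr1n.
have {}h : 98 / 100 * b <= 2 ^+ C.
  rewrite -(ler_pM2r (mulr_gt0 b0 a0)); lra.
lra.
Qed.

(** * Combination of the two bounds *)

Lemma bb_lower_bound (R : realType) (s d L : nat)
    (dsp : measure_display) (T : measurableType dsp) (P : probability T R)
    (prot : T -> bb_protocol s (seq (constraint d))) (C : nat) :
  (2 <= s)%N -> (2 <= d)%N -> (1 <= L)%N ->
  tests_feasibility P L (fun r => bb_output (prot r)) ->
  sends_at_most L (fun r => bb_bits (prot r)) C ->
  10^-1 * (s%:R + L%:R) <= C%:R :> R.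
Proof.
case: s prot => [|[|s]]// prot; case: d prot => [|[|d]]// prot _ _ L1 test send.
have sC := bb_servers_lower_bound L1 test send.
have LC : (L %/ 4 <= C)%N.
  by apply: (bb_bits_lower_bound L1 _ test send); rewrite mulnC leq_divM.
(* Rounding in [L %/ 4] gives [L <= 4 * C + 3]; positivity of [C] absorbs the 3. *)
have C1 : (1 <= C)%N.
  rewrite lt0n; apply/eqP => C0; move: sC; rewrite C0 -natr1.
  have := ler0n R s; lra.
have LC7 : (L <= 7 * C)%N by lia.
have : L%:R <= 7 * C%:R :> R by rewrite -natrM ler_nat.
have : 1 <= C%:R :> R by rewrite ler1n.
move: sC; rewrite -(natr1 s) -(natr1 s.+1) -(natr1 s); lra.
Qed.

(** If [L <= s ^ 2], the quotient of logarithms is at most 2. Otherwise [s] is below the root of [L]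
    and [ln L] at most twice that root, so the numerator is at most [2 * L]. *)
Lemma mul_ln_div_ln_le (R : realType) (s L : nat) : (2 <= s)%N -> (1 <= L)%N ->
  s%:R * ln L%:R / ln s%:R <= 4 * (s%:R + L%:R) :> R.
Proof.
move=> s2 L1.
have s2R : 2 <= s%:R :> R by rewrite ler_nat.
have L1R : 1 <= L%:R :> R by rewrite ler1n.
(* From [ln (1 + x) <= x] at [x = -1/2]. *)
have ln2 : 2^-1 <= ln 2 :> R.
  have := @le_ln1Dx R (- 2^-1); rewrite (_ : 1 - 2^-1 = 2^-1 :> R); last by lra.
  by rewrite lnV ?posrE// => h; have := h ltac:(lra); lra.
have lns : 2^-1 <= ln s%:R :> R.
  by apply: (le_trans ln2); rewrite ler_ln ?posrE//; lra.
rewrite ler_pdivrMr; last by lra.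
have [Ls|sL] := lerP (L%:R : R) (s%:R ^+ 2).
  have : ln L%:R <= 2 * ln s%:R :> R.
    rewrite mulr_natl -lnXn; last by lra.
    by rewrite ler_ln ?posrE//; [lra|rewrite exprn_gt0//; lra].
  nra.
pose q : R := Num.sqrt L%:R.
have q2 : q ^+ 2 = L%:R by rewrite sqr_sqrtr; lra.
have q0 : 0 < q by rewrite sqrtr_gt0; lra.
have sq : s%:R <= q by rewrite -(@ler_pXn2r _ 2) ?nnegrE//; lra.
have : ln L%:R <= 2 * q.
  by rewrite -q2 lnXn// mulr2n; have := ln_sublinear q0; lra.
have : 0 <= ln L%:R :> R by rewrite ln_ge0.
nra.
Qed.

Theorem theorem8p2 (R : realType) :
  (exists2 c : R, 0 < c &
     forall (s d L : nat), (2 <= s)%N -> (2 <= d)%N -> (1 <= L)%N ->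
     forall (dsp : measure_display) (T : measurableType dsp)
       (P : probability T R) (prot : T -> coord_protocol s (seq (constraint d)))
       (C : nat),
     tests_feasibility P L (fun r => coord_output (prot r)) ->
     sends_at_most L (fun r => coord_bits (prot r)) C ->
     c * (s%:R * ln L%:R / ln s%:R) <= C%:R)
  /\
  (exists2 c : R, 0 < c &
     forall (s d L : nat), (2 <= s)%N -> (2 <= d)%N -> (1 <= L)%N ->
     forall (dsp : measure_display) (T : measurableType dsp)
       (P : probability T R) (prot : T -> bb_protocol s (seq (constraint d)))
       (C : nat),
     tests_feasibility P L (fun r => bb_output (prot r)) ->
     sends_at_most L (fun r => bb_bits (prot r)) C ->
     c * (s%:R + L%:R) <= C%:R).
Proof.
split; last first.
  exists 10^-1; first by lra.
  by move=> s d L s2 d2 L1 dsp T P prot C; exact: bb_lower_bound.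
(* The factor 10 of the blackboard bound times the 4 of the logarithmic comparison. *)
exists 40^-1; first by lra.
move=> s d L s2 d2 L1 dsp T P prot C test send.
pose bb r :=
  bb_of_coord (server_side (prot r)) (coord_side (prot r)) (fun=> [::]).
have bbE r x : (bb_output (bb r) x, bb_bits (bb r) x) = coord_exec (prot r) x.
  exact: bb_of_coordE.
have : 10^-1 * (s%:R + L%:R) <= C%:R :> R.
  apply: (@bb_lower_bound R s d L dsp T P bb) => //.
    move=> n A b owner AbL.
    have := test n A b owner AbL.
    by rewrite /coord_output; under eq_set do rewrite -bbE.
  move=> n A b owner AbL r.
  by have := send n A b owner AbL r; rewrite /coord_bits -bbE.
have := mul_ln_div_ln_le R s2 L1; lra.
Qed.
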